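(* There exists a domain $\mathcal{X}$ and a concept class $\mathcal{C}\subseteq\{\pm1\}^{\mathcal{X}}$ with $\mathrm{VCdim}(\mathcal{C})=1$ such that the following holds. For every horizon $T\ge 1$ there exists an (oblivious, randomized) adversary strategy in the adversarial injection model with unknown $\mathcal{D}$, i.e. a random choice of target $c^\star\in\mathcal{C}$, of distribution $\mathcal{D}$ over $\mathcal{X}$, of the hidden bits $q_1,\dots,q_T$ and of the injected points, all made independently of the learner's actions, such that every learner satisfies \[ \mathbb{E}[err_{\mathrm{mis}}]+\mathbb{E}[err_{\mathrm{abs}}]=\Omega(\sqrt{T}), \] where the constant in $\Omega(\cdot)$ is absolute and the expectation is over the adversary's randomness, the i.i.d. draws and the learner's randomness.
   Context: Adversarial injection model: $\mathcal{X}$ is a domain, $\mathcal{C}\subseteq\{\pm1\}^{\mathcal{X}}$ a concept class. An adversary fixes (possibly at random) a target $c^\star\in\mathcal{C}$ and a distribution $\mathcal{D}$ over $\mathcal{X}$, both unknown to the learner and fixed throughout. For rounds $t=1,\dots,T$: the adversary chooses a hidden bit $q_t\in\{0,1\}$; if $q_t=0$, $x_t\sim\mathcal{D}$ is drawn independently of the past (an i.i.d. round); if $q_t=1$, the adversary chooses $x_t\in\mathcal{X}$ arbitrarily (an injected round). The adversary's choices at round $t$ may depend on the history up to round $t-1$. The learner observes $x_t$ (never $q_t$), outputs $\hat y_t\in\{+1,-1,\perp\}$ (where $\perp$ means abstain), and then observes the true label $y_t=c^\star(x_t)$. The errors are $err_{\mathrm{mis}}=\sum_{t=1}^T\mathbf{1}[\hat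 y_t\ne y_t\wedge \hat y_t\ne\perp]$ and $err_{\mathrm{abs}}=\sum_{t=1}^T\mathbf{1}[\hat y_t=\perp\wedge q_t=0]$. *)

(* Defs.v *)
From Stdlib Require Import Reals List.
Import ListNotations.
Open Scope R_scope.
Set Implicit Arguments.

(** Labels {+1,-1} are encoded as bool (true = +1, false = -1).
    Learner outputs {+1,-1,⊥} are encoded as option bool (None = ⊥). *)

Definition shatters (X : Type) (C : (X -> bool) -> Prop) (S : list X) : Prop :=
  forall b : X -> bool, exists c, C c /\ forall x, In x S -> c x = b x.

Definition VCdim (X : Type) (C : (X -> bool) -> Prop) (d : nat) : Prop :=
  (exists S : list X, NoDup S /\ length S = d /\ shatters C S) /\
  (forall S : list X, NoDup S -> shatters C S -> (length S <= d)%nat).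

Record fdist (A : Type) := FDist {
  fd_sup : list (R * A);
  fd_nonneg : Forall (fun p => 0 <= fst p) fd_sup;
  fd_total : fold_right (fun p s => fst p + s) 0 fd_sup = 1 }.

Definition expect (A : Type) (d : fdist A) (f : A -> R) : R :=
  fold_right (fun p s => fst p * f (snd p) + s) 0 (fd_sup d).

(** An oblivious adversary scenario: target c*, distribution D,
    hidden bits q_t and injected points z_t (rounds indexed 0..T-1). *)
Record scenario (X : Type) := Scenario {
  sc_target : X -> bool;
  sc_D : fdist X;
  sc_q : nat -> bool;
  sc_z : nat -> X }.

(** History entries: (x_s, learner output, true label y_s). *)
Definition history (X : Type) := list (X * option bool * bool).

Definition learner (X : Type) := history X -> X -> fdist (option bool).

(** Loss of a single round: mistake (non-abstaining wrong prediction)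
    plus abstention on an i.i.d. round (q = false). *)
Definition round_err (yh : option bool) (y : bool) (q : bool) : R :=
  match yh with
  | Some b => if Bool.eqb b y then 0 else 1
  | None => if q then 0 else 1
  end.

Fixpoint play (X : Type) (s : scenario X) (L : learner X)
    (n t : nat) (h : history X) : R :=
  match n with
  | O => 0
  | S n' =>
      let c := sc_target s in
      let k := fun x : X =>
        expect (L h x) (fun yh =>
          round_err yh (c x) (sc_q s t) + play s L n' (S t) (h ++ [(x, yh, c x)])) in
      if sc_q s t then k (sc_z s t) else expect (sc_D s) k
  end.

Definition expected_error (X : Type) (A : fdist (scenario X)) (L : learner X)
    (T : nat) : R :=
  expect A (fun s => play s L T 0 []).

(* Main.v *)
Require Import Defs.
From Stdlib Require Import Reals List.
From Stdlib Require Import Arith Lia Lra FunctionalExtensionality.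
Import ListNotations.
Open Scope R_scope.

(** Points are finite sequences of naturals, ordered as a tree, and the concepts
    are the infinite branches, viewed as the sets of their prefixes.  Time is cut
    into about [sqrt T] blocks of length about [sqrt T].  In block [k] every point
    is a uniform child, among about [2 sqrt T], of the node at depth [k] of a
    random branch.  One uniformly chosen block [K] is i.i.d., all the others are
    injected but have the same law, so the learner gets no information on [K] and
    an abstention costs about [1 / sqrt T] in expectation.  A child not seen
    before in its block is on the branch with probability about [1 / sqrt T], so
    predicting costs as much.  Hence each round costs order [1 / sqrt T]. *)

(** * Finite sums and averages *)

Definition lsum {A : Type} (l : list A) (f : A -> R) : R :=
  fold_right (fun x s => f x + s) 0 l.

Lemma lsum_ext {A} (l : list A) f g :
  (forall x, In x l -> f x = g x) -> lsum l f = lsum l g.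
Proof.
  induction l as [|x l IH]; simpl; intros H; [reflexivity|].
  rewrite H, IH; auto.
Qed.

Lemma lsum_le {A} (l : list A) f g :
  (forall x, In x l -> f x <= g x) -> lsum l f <= lsum l g.
Proof.
  induction l as [|x l IH]; simpl; intros H; [lra|].
  apply Rplus_le_compat; auto.
Qed.

Lemma lsum_plus {A} (l : list A) f g :
  lsum l (fun x => f x + g x) = lsum l f + lsum l g.
Proof. induction l as [|x l IH]; simpl; [lra|]. rewrite IH; lra. Qed.

Lemma lsum_scal {A} (l : list A) c f :
  lsum l (fun x => c * f x) = c * lsum l f.
Proof. induction l as [|x l IH]; simpl; [lra|]. rewrite IH; lra. Qed.

Lemma lsum_const {A} (l : list A) c : lsum l (fun _ => c) = INR (length l) * c.
Proof.
  induction l as [|x l IH]; [simpl; lra|].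
  cbn [length]; rewrite S_INR; simpl; rewrite IH; lra.
Qed.

Lemma lsum_swap {A B} (l : list A) (m : list B) f :
  lsum l (fun x => lsum m (f x)) = lsum m (fun y => lsum l (fun x => f x y)).
Proof.
  induction l as [|x l IH]; simpl.
  - rewrite lsum_const; lra.
  - rewrite IH, <- lsum_plus; reflexivity.
Qed.

Lemma lsum_map {A B} (g : A -> B) (l : list A) f :
  lsum (map g l) f = lsum l (fun x => f (g x)).
Proof. induction l as [|x l IH]; simpl; [reflexivity|]. rewrite IH; reflexivity. Qed.

Lemma lsum_app {A} (l m : list A) f : lsum (l ++ m) f = lsum l f + lsum m f.
Proof. induction l as [|x l IH]; simpl; [lra|]. rewrite IH; lra. Qed.

Lemma lsum_prod {A B} (l : list A) (m : list B) f :
  lsum (list_prod l m) f = lsum l (fun x => lsum m (fun y => f (x, y))).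
Proof.
  induction l as [|x l IH]; simpl; [reflexivity|].
  rewrite lsum_app, lsum_map, IH; reflexivity.
Qed.

Lemma lsum_filter {A} (p : A -> bool) (l : list A) f :
  lsum (filter p l) f = lsum l (fun x => if p x then f x else 0).
Proof.
  induction l as [|x l IH]; simpl; [reflexivity|].
  destruct (p x); simpl; rewrite IH; lra.
Qed.

Lemma lsum_ge_term {A} (l : list A) f a :
  In a l -> (forall x, In x l -> 0 <= f x) -> f a <= lsum l f.
Proof.
  induction l as [|x l IH]; simpl; [tauto|]. intros [->|Ha] H.
  - assert (0 <= lsum l f); [|lra].
    rewrite <- (Rmult_0_r (INR (length l))), <- lsum_const.
    apply lsum_le; auto.
  - specialize (IH Ha (fun y Hy => H y (or_intror Hy))).
    specialize (H x (or_introl eq_refl)); lra.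
Qed.

Definition avg {A : Type} (l : list A) (f : A -> R) : R :=
  / INR (length l) * lsum l f.

(** At [n = 0] this rests on [/ 0 = 0]. Thus [avg] of an empty list is 0 and averages are monotone
    over every list. *)
Lemma inv_INR_nonneg n : 0 <= / INR n.
Proof.
  destruct n; [simpl; rewrite Rinv_0; lra|].
  left; apply Rinv_0_lt_compat, lt_0_INR; lia.
Qed.

Lemma avg_ext {A} (l : list A) f g :
  (forall x, In x l -> f x = g x) -> avg l f = avg l g.
Proof. intros H; unfold avg; f_equal; apply lsum_ext, H. Qed.

Lemma avg_le {A} (l : list A) f g :
  (forall x, In x l -> f x <= g x) -> avg l f <= avg l g.
Proof.
  intros H; apply Rmult_le_compat_l; [apply inv_INR_nonneg|apply lsum_le, H].
Qed.

Lemma avg_const {A} (l : list A) c : l <> [] -> avg l (fun _ => c) = c.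
Proof.
  intros H; unfold avg; rewrite lsum_const; field.
  apply not_0_INR; destruct l; simpl; congruence.
Qed.

Lemma avg_scal {A} (l : list A) c f : avg l (fun x => c * f x) = c * avg l f.
Proof. unfold avg; rewrite lsum_scal; ring. Qed.

Lemma avg_lsum {A B} (l : list A) (m : list B) f :
  avg l (fun x => lsum m (f x)) = lsum m (fun y => avg l (fun x => f x y)).
Proof. unfold avg; rewrite lsum_swap, lsum_scal; reflexivity. Qed.

Lemma avg_swap {A B} (l : list A) (m : list B) f :
  avg l (fun x => avg m (f x)) = avg m (fun y => avg l (fun x => f x y)).
Proof.
  unfold avg at 2 3; rewrite avg_scal, avg_lsum; reflexivity.
Qed.

Lemma avg_map {A B} (g : A -> B) (l : list A) f :
  avg (map g l) f = avg l (fun x => f (g x)).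
Proof. unfold avg; rewrite length_map, lsum_map; reflexivity. Qed.

Lemma avg_prod {A B} (l : list A) (m : list B) f :
  avg (list_prod l m) f = avg l (fun x => avg m (fun y => f (x, y))).
Proof.
  unfold avg; rewrite lsum_prod, lsum_scal, length_prod, mult_INR, Rinv_mult.
  ring.
Qed.

(** * Expectations under finite and uniform distributions *)

Lemma expect_lsum {A} (d : fdist A) f :
  expect d f = lsum (fd_sup d) (fun p => fst p * f (snd p)).
Proof. reflexivity. Qed.

Lemma expect_le {A} (d : fdist A) f g :
  (forall x, f x <= g x) -> expect d f <= expect d g.
Proof.
  intros H; rewrite !expect_lsum; apply lsum_le; intros p Hp.
  apply Rmult_le_compat_l; [|apply H].
  exact (proj1 (Forall_forall _ _) (fd_nonneg d) p Hp).
Qed.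

Lemma expect_ext {A} (d : fdist A) f g :
  (forall x, f x = g x) -> expect d f = expect d g.
Proof. intros H; rewrite !expect_lsum; apply lsum_ext; intros; rewrite H; auto. Qed.

Lemma expect_const {A} (d : fdist A) c : expect d (fun _ => c) = c.
Proof.
  rewrite expect_lsum.
  rewrite (lsum_ext _ _ (fun p => c * fst p)) by (intros; ring).
  rewrite lsum_scal.
  replace (lsum (fd_sup d) fst) with 1; [ring|].
  symmetry; exact (fd_total d).
Qed.

Lemma expect_plus {A} (d : fdist A) f g :
  expect d (fun x => f x + g x) = expect d f + expect d g.
Proof.
  rewrite !expect_lsum, <- lsum_plus; apply lsum_ext; intros; ring.
Qed.

Lemma lsum_expect {A B} (l : list A) (d : fdist B) f :
  lsum l (fun x => expect d (f x)) = expect d (fun y => lsum l (fun x => f x y)).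
Proof.
  rewrite expect_lsum, (lsum_ext l _ (fun x => lsum (fd_sup d)
    (fun p => fst p * f x (snd p)))) by reflexivity.
  rewrite lsum_swap; apply lsum_ext; intros; apply lsum_scal.
Qed.

Lemma avg_expect {A B} (l : list A) (d : fdist B) f :
  avg l (fun x => expect d (f x)) = expect d (fun y => avg l (fun x => f x y)).
Proof.
  unfold avg; rewrite lsum_expect, !expect_lsum, <- lsum_scal.
  apply lsum_ext; intros; ring.
Qed.

Lemma uniform_nonneg {A} (l : list A) :
  Forall (fun p : R * A => 0 <= fst p) (map (fun x => (/ INR (length l), x)) l).
Proof.
  apply Forall_map, Forall_forall; intros; apply inv_INR_nonneg.
Qed.

Lemma uniform_total {A} (l : list A) (H : l <> []) :
  fold_right (fun (p : R * A) s => fst p + s) 0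
    (map (fun x => (/ INR (length l), x)) l) = 1.
Proof.
  change (lsum (map (fun x => (/ INR (length l), x)) l) fst = 1).
  rewrite lsum_map; simpl; rewrite lsum_const; field.
  apply not_0_INR; destruct l; simpl; congruence.
Qed.

Definition uniform {A} (l : list A) (H : l <> []) : fdist A :=
  FDist (uniform_nonneg l) (uniform_total l H).

Lemma expect_uniform {A} (l : list A) (H : l <> []) f :
  expect (uniform l H) f = avg l f.
Proof.
  rewrite expect_lsum; simpl; rewrite lsum_map; simpl.
  apply lsum_scal.
Qed.

(** The entries of [s] that occur in [l] form a duplicate-free list included in [l], so there are at
    most [length l] of them. *)
Lemma count_notin (l s : list nat) :
  NoDup s ->
  (length s <=
   length (filter (fun i => negb (existsb (Nat.eqb i) l)) s) + length l)%nat.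
Proof.
  intros H; rewrite <- (filter_length (fun i => existsb (Nat.eqb i) l) s).
  rewrite Nat.add_comm; apply Nat.add_le_mono_l.
  apply NoDup_incl_length; [apply NoDup_filter, H|].
  intros i Hi; apply filter_In in Hi; destruct Hi as [_ Hi].
  apply existsb_exists in Hi; destruct Hi as [j [Hj E]].
  apply Nat.eqb_eq in E; subst; exact Hj.
Qed.

Lemma existsb_eqb_false i l : existsb (Nat.eqb i) l = false <-> ~ In i l.
Proof.
  rewrite <- Bool.not_true_iff_false, existsb_exists; split; intros H E; apply H.
  - exists i; split; [exact E|apply Nat.eqb_refl].
  - destruct E as [j [Hj E]]; apply Nat.eqb_eq in E; subst; exact Hj.
Qed.

(** * Uniform random sequences *)

Definition upd (f : nat -> nat) (t i : nat) : nat -> nat :=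
  fun s => if Nat.eqb s t then i else f s.

Lemma upd_eq f t i : upd f t i t = i.
Proof. unfold upd; rewrite Nat.eqb_refl; reflexivity. Qed.

Lemma upd_neq f t i s : s <> t -> upd f t i s = f s.
Proof. intros H; unfold upd; apply Nat.eqb_neq in H; rewrite H; reflexivity. Qed.

Lemma upd_upd f t i j : upd (upd f t i) t j = upd f t j.
Proof. extensionality s; unfold upd; destruct (Nat.eqb s t); reflexivity. Qed.

Lemma upd_comm f t i s j : s <> t -> upd (upd f s j) t i = upd (upd f t i) s j.
Proof.
  intros H; extensionality r; unfold upd.
  destruct (Nat.eqb_spec r t), (Nat.eqb_spec r s); congruence.
Qed.

(* All sequences with entries below [M] at positions [t, ..., t + n - 1]
   and zero elsewhere. *)
Fixpoint seqs (M n t : nat) : list (nat -> nat) :=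
  match n with
  | O => [fun _ => 0%nat]
  | S n' => map (fun p => upd (snd p) t (fst p))
              (list_prod (seq 0 M) (seqs M n' (S t)))
  end.

Lemma avg_seqs_S M n t F :
  avg (seqs M (S n) t) F =
  avg (seq 0 M) (fun i => avg (seqs M n (S t)) (fun g => F (upd g t i))).
Proof. cbn [seqs]; rewrite avg_map, avg_prod; reflexivity. Qed.

Lemma seqs_bound M n t g s :
  In g (seqs M n t) -> (t <= s < t + n)%nat -> (g s < M)%nat.
Proof.
  revert t g; induction n as [|n IH]; intros t g Hg Hs; [lia|].
  cbn [seqs] in Hg; apply in_map_iff in Hg; destruct Hg as [[i f] [E Hp]].
  apply in_prod_iff in Hp; destruct Hp as [Hi Hf]; apply in_seq in Hi.
  simpl in E; subst g; destruct (Nat.eq_dec s t) as [->|Hst].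
  - rewrite upd_eq; lia.
  - rewrite upd_neq by exact Hst; apply (IH (S t)); [exact Hf|lia].
Qed.

Lemma seq_neq_nil M : (0 < M)%nat -> seq 0 M <> [].
Proof. destruct M; simpl; [lia|congruence]. Qed.

Lemma list_prod_neq_nil {A B} (l : list A) (m : list B) :
  l <> [] -> m <> [] -> list_prod l m <> [].
Proof. destruct l, m; simpl; congruence. Qed.

Lemma map_neq_nil {A B} (f : A -> B) l : l <> [] -> map f l <> [].
Proof. destruct l; simpl; congruence. Qed.

Lemma seqs_neq_nil M n t : (0 < M)%nat -> seqs M n t <> [].
Proof.
  intros HM; revert t; induction n as [|n IH]; intros t; [discriminate|].
  apply map_neq_nil, list_prod_neq_nil; [apply seq_neq_nil, HM|apply IH].
Qed.

(** The entries are independent and uniform, so redrawing entry [s] preserves the law. This serves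
    as conditioning on all the other entries. *)
Lemma avg_seqs_resample M n t s F :
  (0 < M)%nat -> (t <= s < t + n)%nat ->
  avg (seqs M n t) F =
  avg (seqs M n t) (fun g => avg (seq 0 M) (fun i => F (upd g s i))).
Proof.
  intros HM; revert t F; induction n as [|n IH]; intros t F Hs; [lia|].
  rewrite !avg_seqs_S; destruct (Nat.eq_dec s t) as [->|Hst].
  (* The redraw overwrites entry [t], so the outer average over [i] is that of a constant. *)
  - rewrite (avg_ext (seq 0 M) (fun i => avg (seqs M n (S t)) (fun g =>
      avg (seq 0 M) (fun j => F (upd (upd g t i) t j))))
      (fun _ => avg (seqs M n (S t)) (fun g =>
      avg (seq 0 M) (fun j => F (upd g t j))))).
    + rewrite avg_const by (apply seq_neq_nil, HM); apply avg_swap.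
    + intros i _; apply avg_ext; intros g _; apply avg_ext; intros j _.
      rewrite upd_upd; reflexivity.
  - apply avg_ext; intros i _; rewrite IH by lia.
    apply avg_ext; intros g _; apply avg_ext; intros j _.
    rewrite upd_comm by exact Hst; reflexivity.
Qed.

(** * The learner on a fixed sequence of labelled points *)

Section Transcript.
Context {X : Type} (L : learner X).

(** Unlike in [play], points and labels are fixed beforehand, which leaves only the learner's
    randomness. The loss is a parameter so that it can later be averaged over the i.i.d. block. *)
Fixpoint transcript_loss (x : nat -> X) (y : nat -> bool)
    (l : nat -> option bool -> bool -> R) (n t : nat) (h : history X) : R :=
  match n with
  | O => 0
  | S n' => expect (L h (x t)) (fun yh =>
      l t yh (y t) + transcript_loss x y l n' (S t) (h ++ [(x t, yh, y t)]))
  end.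

Fixpoint transcript_expect (x : nat -> X) (y : nat -> bool)
    (n t : nat) (h : history X) (f : history X -> R) : R :=
  match n with
  | O => f h
  | S n' => expect (L h (x t)) (fun yh =>
      transcript_expect x y n' (S t) (h ++ [(x t, yh, y t)]) f)
  end.

Lemma transcript_loss_ext x y x' y' l n t h :
  (forall s, (t <= s)%nat -> x s = x' s /\ y s = y' s) ->
  transcript_loss x y l n t h = transcript_loss x' y' l n t h.
Proof.
  revert t h; induction n as [|n IH]; intros t h H; simpl; [reflexivity|].
  destruct (H t (le_n t)) as [-> ->].
  apply expect_ext; intros yh; f_equal; apply IH; intros s Hs; apply H; lia.
Qed.

(** The range stops before [t + n]: the history that the learner holds at round [t + n] ignores the
    point and the label of that round. *)
Lemma transcript_expect_ext x y x' y' n t h f :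
  (forall s, (t <= s < t + n)%nat -> x s = x' s /\ y s = y' s) ->
  transcript_expect x y n t h f = transcript_expect x' y' n t h f.
Proof.
  revert t h; induction n as [|n IH]; intros t h H; simpl; [reflexivity|].
  destruct (H t) as [-> ->]; [lia|].
  apply expect_ext; intros yh; apply IH; intros s Hs; apply H; lia.
Qed.

Lemma transcript_expect_le x y n t h f g :
  (forall h, f h <= g h) ->
  transcript_expect x y n t h f <= transcript_expect x y n t h g.
Proof.
  intros H; revert t h; induction n as [|n IH]; intros t h; simpl; [apply H|].
  apply expect_le; intros yh; apply IH.
Qed.

Lemma transcript_expect_const x y n t h c :
  transcript_expect x y n t h (fun _ => c) = c.
Proof.
  revert t h; induction n as [|n IH]; intros t h; simpl; [reflexivity|].
  rewrite (expect_ext _ _ (fun _ => c)) by (intros; apply IH).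
  apply expect_const.
Qed.

Lemma lsum_transcript_expect {A} (m : list A) x y n t h f :
  lsum m (fun a => transcript_expect x y n t h (f a)) =
  transcript_expect x y n t h (fun h => lsum m (fun a => f a h)).
Proof.
  revert t h; induction n as [|n IH]; intros t h; simpl; [reflexivity|].
  rewrite lsum_expect; apply expect_ext; intros yh; apply IH.
Qed.

(** The loss never enters the history, so the learner's outputs have the same law for every [a], and
    linearity averages the loss round by round. *)
Lemma avg_transcript_loss {A} (m : list A) x y (l : A -> nat -> _) n t h :
  avg m (fun a => transcript_loss x y (l a) n t h) =
  transcript_loss x y (fun s yh b => avg m (fun a => l a s yh b)) n t h.
Proof.
  revert t h; induction n as [|n IH]; intros t h; simpl.
  - unfold avg; rewrite lsum_const; ring.
  - rewrite avg_expect; apply expect_ext; intros yh.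
    rewrite <- IH; unfold avg; rewrite lsum_plus; ring.
Qed.

Lemma transcript_loss_ext_loss x y l l' n t h :
  (forall s yh b, (t <= s < t + n)%nat -> l s yh b = l' s yh b) ->
  transcript_loss x y l n t h = transcript_loss x y l' n t h.
Proof.
  revert t h; induction n as [|n IH]; intros t h H; simpl; [reflexivity|].
  apply expect_ext; intros yh; rewrite H by lia.
  rewrite IH; [reflexivity|]; intros; apply H; lia.
Qed.

Lemma transcript_loss_by_rounds x y l n t h :
  transcript_loss x y l n t h =
  lsum (seq 0 n) (fun s => transcript_expect x y s t h (fun h =>
    expect (L h (x (t + s)%nat)) (fun yh => l (t + s)%nat yh (y (t + s)%nat)))).
Proof.
  revert t h; induction n as [|n IH]; intros t h; [reflexivity|].
  cbn [seq]; rewrite <- seq_shift; cbn [lsum fold_right transcript_loss].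
  change (fold_right ?f 0 (map S (seq 0 n))) with
    (lsum (map S (seq 0 n)) (fun s => transcript_expect x y s t h (fun h =>
    expect (L h (x (t + s)%nat)) (fun yh => l (t + s)%nat yh (y (t + s)%nat))))).
  rewrite lsum_map, expect_plus; simpl; rewrite Nat.add_0_r; f_equal.
  rewrite lsum_expect; apply expect_ext; intros yh; rewrite IH.
  apply lsum_ext; intros s _; rewrite <- plus_n_Sm; reflexivity.
Qed.

End Transcript.

(** * Branches of the tree of finite sequences *)

Definition branch (a : nat -> nat) (x : list nat) : bool :=
  if list_eq_dec Nat.eq_dec x (map a (seq 0 (length x))) then true else false.

Definition branches (c : list nat -> bool) : Prop := exists a, c = branch a.

Definition child (a : nat -> nat) (k i : nat) : list nat :=
  map a (seq 0 k) ++ [i].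

Lemma branch_child a k i : branch a (child a k i) = Nat.eqb i (a k).
Proof.
  unfold branch, child; rewrite length_app, length_map, length_seq; simpl.
  rewrite Nat.add_1_r, seq_S, map_app; simpl.
  destruct list_eq_dec as [E|E], (Nat.eqb_spec i (a k)) as [E'|E'];
    try reflexivity.
  - apply app_inj_tail in E; tauto.
  - subst; congruence.
Qed.

(** A point of block [k] uses only the entries of the branch below [k], so by itself it says nothing
    about the entry at [k]. *)
Lemma child_ext a b k i :
  (forall j, (j < k)%nat -> a j = b j) -> child a k i = child b k i.
Proof.
  intros H; unfold child; f_equal; apply map_ext_in; intros j Hj.
  apply in_seq in Hj; apply H; lia.
Qed.

Lemma branch_true a x : branch a x = true <-> x = map a (seq 0 (length x)).
Proof. unfold branch; destruct list_eq_dec; split; congruence. Qed.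

(** Two nodes on a common branch are comparable, so every branch through the longer one passes
    through the shorter one. *)
Lemma branch_prefix a b x y :
  (length x <= length y)%nat -> branch a x = true -> branch a y = true ->
  branch b y = true -> branch b x = true.
Proof.
  rewrite !branch_true; intros Hl Hx Hy Hb.
  rewrite Hx, length_map, length_seq; apply map_ext_in; intros i Hi.
  apply in_seq in Hi; rewrite Hy in Hb at 1.
  assert (E : nth i (map a (seq 0 (length y))) (b 0%nat) =
              nth i (map b (seq 0 (length y))) (b 0%nat)) by (rewrite Hb; auto).
  rewrite (nth_indep (map a _) _ (a 0%nat)), !map_nth, !seq_nth in E
    by (try rewrite length_map, length_seq; lia).
  exact E.
Qed.

Lemma VCdim_branches : VCdim branches 1.
Proof.
  split.
  - exists [[0%nat]]; split; [repeat constructor; simpl; tauto|].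
    split; [reflexivity|]; intros b.
    exists (branch (fun _ => if b [0%nat] then 0%nat else 1%nat)).
    split; [eexists; reflexivity|].
    intros x [<-|[]]; destruct (b [0%nat]); reflexivity.
  - intros S HS Hsh; destruct S as [|x [|y S]]; simpl; try lia.
    exfalso; assert (Hxy : x <> y).
    { inversion HS as [|? ? Hx _]; subst; intros ->; apply Hx; left; reflexivity. }
    (* The all-positive pattern puts [x] and [y] on a common branch. Then the pattern with only the
       longer one positive contradicts [branch_prefix]. *)
    destruct (Hsh (fun _ => true)) as [c [[a ->] Ha]].
    pose proof (Ha x (or_introl eq_refl)) as Hx.
    pose proof (Ha y (or_intror (or_introl eq_refl))) as Hy.
    destruct (Nat.le_ge_cases (length x) (length y)) as [Hl|Hl].
    + destruct (Hsh (fun z => if list_eq_dec Nat.eq_dec z y then true else false))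
        as [c [[b ->] Hb]].
      pose proof (Hb x (or_introl eq_refl)) as Hbx.
      pose proof (Hb y (or_intror (or_introl eq_refl))) as Hby.
      cbv beta in Hbx, Hby.
      destruct (list_eq_dec Nat.eq_dec x y), (list_eq_dec Nat.eq_dec y y); try congruence.
      rewrite (branch_prefix _ _ _ _ Hl Hx Hy Hby) in Hbx; discriminate.
    + destruct (Hsh (fun z => if list_eq_dec Nat.eq_dec z x then true else false))
        as [c [[b ->] Hb]].
      pose proof (Hb x (or_introl eq_refl)) as Hbx.
      pose proof (Hb y (or_intror (or_introl eq_refl))) as Hby.
      cbv beta in Hbx, Hby.
      destruct (list_eq_dec Nat.eq_dec y x), (list_eq_dec Nat.eq_dec x x); try congruence.
      rewrite (branch_prefix _ _ _ _ Hl Hy Hx Hbx) in Hby; discriminate.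
Qed.

(** * The adversary *)

(** Lets the entry of round [t] be changed once that round is over. *)
Lemma play_ext (X : Type) (s s' : scenario X) L n t h :
  sc_target s = sc_target s' -> sc_D s = sc_D s' -> sc_q s = sc_q s' ->
  (forall r, (t <= r)%nat -> sc_z s r = sc_z s' r) ->
  play s L n t h = play s' L n t h.
Proof.
  intros Hc HD Hq; revert t h; induction n as [|n IH]; intros t h Hz;
    simpl; [reflexivity|].
  rewrite Hc, HD, Hq, (Hz t (le_n t)).
  assert (E : forall h, play s L n (S t) h = play s' L n (S t) h)
    by (intros; apply IH; intros; apply Hz; lia).
  destruct (sc_q s' t); [|apply expect_ext; intros x];
    apply expect_ext; intros yh; rewrite E; reflexivity.
Qed.

Section Adversary.
(* [B] is the length of a block, [M] the number of children used in a block and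
   [N] the number of blocks. *)
Variables (B M N : nat).
Hypotheses (HB : (0 < B)%nat) (HM : (0 < M)%nat) (HN : (0 < N)%nat).
(** [HMB] leaves at least [N] fresh children after up to [B - 1] draws, [HN2] makes at least two of
    them, and [HMN] makes them at least half of all [M] children. *)
Hypotheses (HMB : (N + B <= S M)%nat) (HN2 : (2 <= N)%nat) (HMN : (M <= 2 * N)%nat).

Definition injected (K t : nat) : bool := negb (Nat.eqb (t / B) K).

Definition block_children (a : nat -> nat) (K : nat) : fdist (list nat) :=
  uniform (map (child a K) (seq 0 M)) (map_neq_nil _ _ (seq_neq_nil M HM)).

Definition point (a w : nat -> nat) (t : nat) : list nat := child a (t / B) (w t).

Lemma point_upd a w t i : point a (upd w t i) t = child a (t / B) i.
Proof. unfold point; rewrite upd_eq; reflexivity. Qed.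

(** This equals [branch a (point a w t)] by [branch_child]; the form used shows that the target
    enters only through [a (t / B)]. *)
Definition label (a w : nat -> nat) (t : nat) : bool := Nat.eqb (w t) (a (t / B)%nat).

Lemma label_upd a w t i : label a (upd w t i) t = branch a (child a (t / B) i).
Proof. unfold label; rewrite upd_eq, branch_child; reflexivity. Qed.

Definition block_scenario (K : nat) (a w : nat -> nat) : scenario (list nat) :=
  Scenario (branch a) (block_children a K) (injected K) (point a w).

Definition block_loss (K t : nat) (yh : option bool) (b : bool) : R :=
  round_err yh b (injected K t).

Definition avg_block_loss (t : nat) (yh : option bool) (b : bool) : R :=
  match yh with
  | Some b' => if Bool.eqb b' b then 0 else 1
  | None => / INR N
  end.

Variable L : learner (list nat).

(* The i.i.d. draws of block [K] are replaced by the entries of [w], which have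
   the same law. *)
Lemma avg_play K a n t h :
  avg (seqs M n t) (fun w => play (block_scenario K a w) L n t h) =
  avg (seqs M n t) (fun w =>
    transcript_loss L (point a w) (label a w) (block_loss K) n t h).
Proof.
  revert t h; induction n as [|n IH]; intros t h; [reflexivity|].
  rewrite !avg_seqs_S.
  (* [k w x] is the expected loss from round [t] on when the point of that round is [x]. *)
  set (k := fun w x => expect (L h x) (fun yh =>
    round_err yh (branch a x) (injected K t) +
    play (block_scenario K a w) L n (S t) (h ++ [(x, yh, branch a x)]))).
  transitivity (avg (seq 0 M) (fun i => avg (seqs M n (S t))
                  (fun w => k w (child a (t / B) i)))).
  - destruct (injected K t) eqn:Eq.
    + apply avg_ext; intros i _; apply avg_ext; intros w _.
      simpl; rewrite Eq, point_upd; unfold k.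
      apply expect_ext; intros yh; f_equal.
      apply play_ext; try reflexivity; simpl; intros r Hr.
      unfold point; rewrite upd_neq by lia; reflexivity.
    + assert (EK : (t / B)%nat = K).
      { unfold injected in Eq; apply Bool.negb_false_iff in Eq.
        apply Nat.eqb_eq, Eq. }
      (* In an i.i.d. round, [play] draws its own child and ignores entry [t] of [w]; the average
         over that entry is trivial and the fresh draw takes its place. *)
      rewrite (avg_ext (seq 0 M) _ (fun _ => avg (seqs M n (S t)) (fun w =>
        avg (seq 0 M) (fun i => k w (child a K i))))).
      * rewrite avg_const by (apply seq_neq_nil, HM).
        rewrite avg_swap, EK; reflexivity.
      * intros i _; apply avg_ext; intros w _.
        simpl; rewrite Eq; unfold block_children.
        rewrite expect_uniform, avg_map; apply avg_ext; intros j _.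
        unfold k; apply expect_ext; intros yh; f_equal.
        apply play_ext; try reflexivity; simpl; intros r Hr.
        unfold point; rewrite upd_neq by lia; reflexivity.
  - apply avg_ext; intros i _.
    rewrite (avg_ext (seqs M n (S t)) (fun g => transcript_loss _ _ _ _ _ _ _)
      (fun w => expect (L h (child a (t / B) i)) (fun yh =>
        round_err yh (branch a (child a (t / B) i)) (injected K t) +
        transcript_loss L (point a w) (label a w) (block_loss K) n (S t)
         (h ++ [(child a (t / B) i, yh, branch a (child a (t / B) i))])))).
    + unfold k; rewrite !avg_expect; apply expect_ext; intros yh.
      unfold avg at 1 2; rewrite !lsum_plus, !Rmult_plus_distr_l.
      f_equal; apply IH.
    + intros w _; cbn [transcript_loss].
      rewrite point_upd, label_upd.
      apply expect_ext; intros yh; f_equal.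
      apply transcript_loss_ext; intros s Hs.
      unfold point, label; rewrite upd_neq by lia; auto.
Qed.

(** Only [K = t / B] makes round [t] i.i.d., so an abstention costs [1 / N] on average, while the
    cost of a prediction does not depend on [K]. *)
Lemma avg_block_loss_eq t yh b :
  (t / B < N)%nat ->
  avg (seq 0 N) (fun K => block_loss K t yh b) = avg_block_loss t yh b.
Proof.
  intros Ht; destruct yh as [b'|]; cbn [avg_block_loss].
  - exact (avg_const (seq 0 N) _ (seq_neq_nil N HN)).
  - unfold avg; rewrite length_seq.
    enough (E : lsum (seq 0 N) (fun K => block_loss K t None b) = 1)
      by (rewrite E; ring).
    rewrite (lsum_ext _ _ (fun K => if Nat.eqb K (t / B) then 1 else 0)).
    + assert (HP : forall n m, (m <= t / B < m + n)%nat ->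
        lsum (seq m n) (fun K => if Nat.eqb K (t / B) then 1 else 0) = 1);
        [|apply HP; lia].
      induction n as [|n IH]; intros m Hm; [lia|]; simpl.
      destruct (Nat.eqb_spec m (t / B)) as [E|E].
      * rewrite (lsum_ext _ _ (fun _ => 0)), lsum_const; [ring|].
        intros K HK; apply in_seq in HK.
        destruct (Nat.eqb_spec K (t / B)); [lia|reflexivity].
      * rewrite IH by lia; ring.
    + intros K _; unfold block_loss, injected; simpl.
      rewrite Nat.eqb_sym; destruct (Nat.eqb K (t / B)); reflexivity.
Qed.

(** * Children not yet drawn in the current block, and the cost of one round *)

Definition earlier (w : nat -> nat) (t : nat) : list nat :=
  map w (seq (t / B * B) (t - t / B * B)).

Lemma length_earlier w t : (length (earlier w t) < B)%nat.
Proof.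
  unfold earlier; rewrite length_map, length_seq.
  pose proof (Nat.div_mod_eq t B); pose proof (Nat.mod_upper_bound t B); lia.
Qed.

Definition unseen (w : nat -> nat) (t i : nat) : bool :=
  negb (existsb (Nat.eqb i) (earlier w t)).

Lemma unseen_true w t i : unseen w t i = true <-> ~ In i (earlier w t).
Proof. unfold unseen; rewrite Bool.negb_true_iff; apply existsb_eqb_false. Qed.

Lemma count_unseen w t : (N <= length (filter (unseen w t) (seq 0 M)))%nat.
Proof.
  pose proof (count_notin (earlier w t) (seq 0 M) (seq_NoDup M 0)) as H.
  rewrite length_seq in H; pose proof (length_earlier w t).
  unfold unseen; lia.
Qed.

(** Expected loss of round [t] over the learner's randomness alone, with [K] already averaged
    out. *)
Definition round_loss (a w : nat -> nat) (t : nat) : R :=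
  transcript_expect L (point a w) (label a w) t 0 [] (fun h =>
    expect (L h (point a w t)) (fun yh => avg_block_loss t yh (label a w t))).

Lemma avg_block_loss_nonneg t yh b : 0 <= avg_block_loss t yh b.
Proof.
  destruct yh as [b'|]; simpl; [destruct Bool.eqb; lra|apply inv_INR_nonneg].
Qed.

Lemma round_loss_nonneg a w t : 0 <= round_loss a w t.
Proof.
  unfold round_loss; rewrite <- (transcript_expect_const L (point a w) (label a w) t 0 [] 0).
  apply transcript_expect_le; intros h.
  rewrite <- (expect_const (L h (point a w t)) 0).
  apply expect_le; intros; apply avg_block_loss_nonneg.
Qed.

(** Here [i] ranges over the values of the branch entry still possible when all earlier labels of
    the block are negative. Each of the three outputs costs at least 1 in total over them. *)
Lemma sum_avg_block_loss w t yh :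
  unseen w t (w t) = true -> (w t < M)%nat ->
  1 <= lsum (filter (unseen w t) (seq 0 M))
         (fun i => avg_block_loss t yh (Nat.eqb (w t) i)).
Proof.
  intros Hu Hw; pose proof (count_unseen w t) as Hc.
  set (l := filter (unseen w t) (seq 0 M)) in *.
  assert (Hin : In (w t) l) by (apply filter_In; split; [apply in_seq; lia|exact Hu]).
  assert (Hnd : NoDup l) by (apply NoDup_filter, seq_NoDup).
  destruct yh as [[|]|].
  (* A positive prediction is wrong for any other unseen child [j], which exists since [2 <= N]. *)
  - assert (exists j, In j l /\ j <> w t) as [j [Hj Hne]].
    { clearbody l; destruct l as [|i [|j l]]; simpl in Hc; try lia.
      inversion Hnd as [|? ? Hi _]; subst.
      destruct (Nat.eq_dec i (w t)) as [->|Hi'].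
      - exists j; split; [right; left; reflexivity|].
        intros ->; apply Hi; left; reflexivity.
      - exists i; split; [left; reflexivity|exact Hi']. }
    eapply Rle_trans; [|apply lsum_ge_term with (a := j);
      [exact Hj|intros; apply avg_block_loss_nonneg]].
    destruct (Nat.eqb_spec (w t) j); [congruence|simpl; lra].
  (* A negative prediction is wrong when the branch goes through the current point. *)
  - eapply Rle_trans; [|apply lsum_ge_term with (a := w t);
      [exact Hin|intros; apply avg_block_loss_nonneg]].
    rewrite Nat.eqb_refl; simpl; lra.
  (* An abstention pays [1 / N] for each of at least [N] values. *)
  - unfold avg_block_loss; rewrite lsum_const.
    assert (0 < INR N) by (apply lt_0_INR; lia).
    apply Rmult_le_reg_r with (INR N); [assumption|].
    rewrite Rmult_assoc, Rinv_l by lra.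
    apply le_INR in Hc; lra.
Qed.

(* As long as the branch avoids the earlier points of the block, the history does
   not depend on its next entry [i]. *)
Lemma sum_round_loss a w t :
  unseen w t (w t) = true -> (w t < M)%nat ->
  1 <= lsum (seq 0 M) (fun i => round_loss (upd a (t / B) i) w t).
Proof.
  intros Hu Hw; set (k := (t / B)%nat).
  apply Rle_trans with (lsum (filter (unseen w t) (seq 0 M))
    (fun i => round_loss (upd a k i) w t)).
  2:{ rewrite lsum_filter; apply lsum_le; intros i _.
      pose proof (round_loss_nonneg (upd a k i) w t).
      destruct (unseen w t i); lra. }
  (* A reference branch: its entry at [k] is itself unseen, so it yields the same history as any
     other unseen [i]. *)
  set (a0 := upd a k (w t)).
  assert (Hpt : forall i s, (s <= t)%nat -> point (upd a k i) w s = point a0 w s).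
  { intros i s Hs; apply child_ext; intros j Hj.
    assert (s / B <= k)%nat by (apply Nat.Div0.div_le_mono, Hs).
    unfold a0; rewrite !upd_neq by lia; reflexivity. }
  rewrite (lsum_ext _ _ (fun i => transcript_expect L (point a0 w) (label a0 w) t 0 []
    (fun h => expect (L h (point a0 w t)) (fun yh =>
       avg_block_loss t yh (Nat.eqb (w t) i))))).
  - rewrite lsum_transcript_expect.
    rewrite <- (transcript_expect_const L (point a0 w) (label a0 w) t 0 [] 1) at 1.
    apply transcript_expect_le; intros h; rewrite lsum_expect.
    rewrite <- (expect_const (L h (point a0 w t)) 1) at 1.
    apply expect_le; intros yh; apply sum_avg_block_loss; assumption.
  - intros i Hi; apply filter_In in Hi; destruct Hi as [_ Hi].
    unfold round_loss; rewrite Hpt by lia.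
    unfold label at 2; fold k; rewrite upd_eq.
    apply transcript_expect_ext; intros s Hs; split; [apply Hpt; lia|].
    (* Within the block, [w s] differs from both [i] and [w t], so both labels are negative. In
       other blocks the label does not involve entry [k]. *)
    unfold label, a0; destruct (Nat.eq_dec (s / B) k) as [E|E].
    + assert (Hin : In (w s) (earlier w t)).
      { apply in_map, in_seq; fold k; rewrite <- E.
        pose proof (Nat.div_mod_eq s B); lia. }
      rewrite E, !upd_eq.
      apply unseen_true in Hi, Hu.
      destruct (Nat.eqb_spec (w s) i), (Nat.eqb_spec (w s) (w t)); congruence.
    + rewrite !upd_neq by exact E; reflexivity.
Qed.

(** Redrawing [w t] leaves [earlier w t] unchanged, and at least [N] of the [M] values are unseen, a
    fraction of at least one half. *)
Lemma avg_unseen n t :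
  (t < n)%nat ->
  / 2 <= avg (seqs M n 0) (fun w => if unseen w t (w t) then 1 else 0).
Proof.
  intros Ht; rewrite (avg_seqs_resample M n 0 t) by lia.
  rewrite <- (avg_const (seqs M n 0) (/ 2)) by (apply seqs_neq_nil, HM).
  apply avg_le; intros w _.
  rewrite (avg_ext (seq 0 M) _ (fun i => if unseen w t i then 1 else 0)).
  - unfold avg; rewrite <- lsum_filter, lsum_const, length_seq.
    pose proof (count_unseen w t) as H; apply le_INR in H.
    assert (HM' : 0 < INR M) by (apply lt_0_INR; lia).
    assert (H2 : INR M <= 2 * INR N).
    { change 2 with (INR 2); rewrite <- mult_INR; apply le_INR; lia. }
    apply Rmult_le_reg_l with (INR M); [assumption|].
    rewrite <- Rmult_assoc, Rinv_r; lra.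
  - intros i _; unfold unseen, earlier; rewrite upd_eq.
    rewrite (map_ext_in (upd w t i) w); [reflexivity|].
    intros s Hs; apply in_seq in Hs; apply upd_neq.
    pose proof (Nat.div_mod_eq t B); lia.
Qed.

(** * The uniform mixture of scenarios and its lower bound *)

Definition adversary_scenarios (T : nat) : list (scenario (list nat)) :=
  map (fun p => block_scenario (fst p) (fst (snd p)) (snd (snd p)))
    (list_prod (seq 0 N) (list_prod (seqs M N 0) (seqs M T 0))).

Lemma adversary_scenarios_neq_nil T : adversary_scenarios T <> [].
Proof.
  apply map_neq_nil, list_prod_neq_nil; [apply seq_neq_nil, HN|].
  apply list_prod_neq_nil; apply seqs_neq_nil, HM.
Qed.

(** Averaging over [w] first removes the i.i.d. draws; after that, points and labels are free of
    [K], so the average over [K] acts on the loss alone. *)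
Lemma expected_error_by_rounds T :
  (forall t, (t < T)%nat -> (t / B < N)%nat) ->
  avg (adversary_scenarios T) (fun s => play s L T 0 []) =
  lsum (seq 0 T) (fun t => avg (seqs M T 0) (fun w =>
    avg (seqs M N 0) (fun a => round_loss a w t))).
Proof.
  intros HT; unfold adversary_scenarios; rewrite avg_map, avg_prod; simpl.
  rewrite (avg_ext (seq 0 N) _ (fun K => avg (seqs M N 0) (fun a =>
    avg (seqs M T 0) (fun w =>
      transcript_loss L (point a w) (label a w) (block_loss K) T 0 [])))).
  2:{ intros K _; rewrite avg_prod; apply avg_ext; intros a _; exact (avg_play K a T 0 []). }
  rewrite avg_swap.
  rewrite (avg_ext (seqs M N 0) _ (fun a => avg (seqs M T 0) (fun w =>
    lsum (seq 0 T) (fun t => round_loss a w t)))).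
  - rewrite avg_swap.
    rewrite (avg_ext (seqs M T 0) _ (fun w => lsum (seq 0 T) (fun t =>
      avg (seqs M N 0) (fun a => round_loss a w t))));
      [apply avg_lsum|intros w _; apply avg_lsum].
  - intros a _; rewrite avg_swap; apply avg_ext; intros w _.
    rewrite avg_transcript_loss.
    rewrite (transcript_loss_ext_loss L _ _ _ avg_block_loss).
    + apply transcript_loss_by_rounds.
    + intros s yh b Hs; apply avg_block_loss_eq, HT; lia.
Qed.

Lemma expected_error_lower T :
  (forall t, (t < T)%nat -> (t / B < N)%nat) ->
  INR T * (/ INR M * / 2) <=
  avg (adversary_scenarios T) (fun s => play s L T 0 []).
Proof.
  intros HT; rewrite expected_error_by_rounds by exact HT.
  rewrite <- (length_seq T 0) at 1; rewrite <- lsum_const.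
  apply lsum_le; intros t Ht; apply in_seq in Ht.
  apply Rle_trans with (/ INR M *
    avg (seqs M T 0) (fun w => if unseen w t (w t) then 1 else 0)).
  - apply Rmult_le_compat_l; [apply inv_INR_nonneg|apply avg_unseen; lia].
  - rewrite <- avg_scal; apply avg_le; intros w Hw.
    (* Redrawing the branch entry of the current block turns the sum bounded by [sum_round_loss]
       into an average of at least [1 / M]. *)
    rewrite (avg_seqs_resample M N 0 (t / B)) by (specialize (HT t); lia).
    rewrite <- (avg_const (seqs M N 0) (/ INR M * _)) by (apply seqs_neq_nil, HM).
    apply avg_le; intros a _; unfold avg; rewrite length_seq.
    apply Rmult_le_compat_l; [apply inv_INR_nonneg|].
    destruct (unseen w t (w t)) eqn:Hu.
    + apply sum_round_loss; [exact Hu|].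
      apply (seqs_bound M T 0); [exact Hw|lia].
    + rewrite <- (Rmult_0_r (INR (length (seq 0 M)))), <- lsum_const.
      apply lsum_le; intros; apply round_loss_nonneg.
Qed.

End Adversary.

(** * Choice of the parameters *)

Theorem theorem3p1 :
  exists (X : Type) (C : (X -> bool) -> Prop),
    VCdim C 1 /\
    exists c : R, 0 < c /\
      forall T : nat, (1 <= T)%nat ->
        exists A : fdist (scenario X),
          Forall (fun p => C (sc_target (snd p))) (fd_sup A) /\
          forall L : learner X,
            c * sqrt (INR T) <= expected_error A L T.
Proof.
  exists (list nat), branches; split; [exact VCdim_branches|].
  (* The bound obtained is [T / (2 (2 B + 2))], and [B + 1 <= 2 sqrt T] turns it into
     [sqrt T / 8]. *)
  exists (/ 8); split; [lra|]; intros T HT.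
  (* Since [T <= B^2 + 2 B], the [N = B + 3] blocks of length [B] cover all rounds; [M = 2 B + 2]
     gives [N + B = M + 1]. *)
  set (B := Nat.sqrt T).
  pose proof (Nat.sqrt_spec T (Nat.le_0_l T)) as HBT; fold B in HBT.
  assert (HB : (1 <= B)%nat) by nia.
  assert (HM : (0 < 2 * B + 2)%nat) by lia.
  assert (HN : (0 < B + 3)%nat) by lia.
  exists (uniform _ (adversary_scenarios_neq_nil B (2 * B + 2) (B + 3) HM HN T)).
  split.
  - apply Forall_map, Forall_map, Forall_forall; intros p _; simpl.
    eexists; reflexivity.
  - intros L; unfold expected_error; rewrite expect_uniform.
    eapply Rle_trans; [|apply expected_error_lower; try lia].
    + assert (Hs : INR B <= sqrt (INR T)).
      { rewrite <- (sqrt_square (INR B)) by apply pos_INR.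
        apply sqrt_le_1_alt; rewrite <- mult_INR; apply le_INR; lia. }
      assert (HB' : 1 <= INR B) by (apply (le_INR 1); lia).
      rewrite <- (sqrt_sqrt (INR T)) at 2 by apply pos_INR.
      rewrite plus_INR, mult_INR; simpl (INR 2).
      set (r := sqrt (INR T)) in *; set (b := INR B) in *.
      apply Rmult_le_reg_r with (8 * (2 * b + 2)); [lra|].
      replace (r * r * (/ ((1 + 1) * b + (1 + 1)) * / 2) * (8 * (2 * b + 2)))
        with (4 * (r * r)) by (field; lra).
      nra.
    + intros t Ht; apply Nat.Div0.div_lt_upper_bound; nia.
Qed.
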